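(* Let $d\in\mathbb{N}$, $d\ge2$, and $s>0$. For $n\ge2$ define $$\alpha(n,d):=2+\log_2\Big(\frac{d}{\log_2 n}+\frac12\Big).$$ For all $n\in\mathbb{N}$ with $2\le n\le\frac d2 4^d$ it holds $$a_n(I_d:H^{s,\#}_{\rm mix}(\mathbb{T}^d)\to L_2(\mathbb{T}^d))\ge 2^{-s}\,n^{-\frac{s}{\alpha(n,d)}} .$$
   Context: $\mathbb{N}=\{1,2,3,\dots\}$. $\mathbb{T}^d$ is the $d$-torus, represented by $[0,2\pi]^d$ with opposite sides identified. $L_2(\mathbb{T}^d)$ carries the norm $\|f|L_2(\mathbb{T}^d)\|=(\int_{\mathbb{T}^d}|f(x)|^2dx)^{1/2}$, and for $f\in L_2(\mathbb{T}^d)$ the Fourier coefficients are $c_k(f)=(2\pi)^{-d/2}\int_{\mathbb{T}^d}f(x)e^{-ikx}dx$, $k\in\mathbb{Z}^d$ (so $\|f|L_2(\mathbb{T}^d)\|^2=\sum_k|c_k(f)|^2$). For $s>0$, $H^{s,\#}_{\rm mix}(\mathbb{T}^d)$ is the space of all $f\in L_2(\mathbb{T}^d)$ for which the norm $$\|f|H^s_{\rm mix}(\mathbb{T}^d)\|^{\#}=\Big[\sum_{k\in\mathbb{Z}^d}|c_k(f)|^2\prod_{j=1}^d(1+|k_j|)^{2s}\Big]^{1/2}$$ is finite, equipped with this norm. $I_d$ denotes the identical embedding $f\mapsto f$. The approximation numbers of a bounded linear operator $T:X\to Y$ between Banach spaces are $a_n(T:X\to Y)=\inf\{\|T-A:X\to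 Y\| : A:X\to Y \text{ bounded linear},\ {\rm rank}\,A<n\}$, $n\in\mathbb{N}$. *)

(* Defs.v *)
From HB Require Import structures.
From mathcomp Require Import all_boot all_order all_algebra.
From mathcomp Require Import ring lra.
From mathcomp Require Import generic_quotient ring_quotient complex.
From mathcomp Require Import all_classical all_reals all_analysis.
From mathcomp Require Import measurable_realfun.

Set Implicit Arguments.
Unset Strict Implicit.
Unset Printing Implicit Defensive.

Import Order.TTheory GRing.Theory Num.Theory.

Local Open Scope classical_set_scope.
Local Open Scope ring_scope.
Local Open Scope complex_scope.

Local Notation Re := complex.Re.
Local Notation Im := complex.Im.
Notation normc := Normc.normc.
(* The points are all d-tuples of reals; the torus enters through the measure,
   which is concentrated on [0, 2 pi]^d, and the almost-everywhere quotient. *)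
Notation torus R d := (d.-tuple (measurableTypeR R)).

Section torus_measure.
Context {R : realType}.

Definition circle_measure : set (measurableTypeR R) -> \bar R :=
  mrestr lebesgue_measure (measurable_itv `[(0 : R), 2 * trigo.pi]).

HB.instance Definition _ := Measure.on circle_measure.

Let circle_fin : fin_num_fun circle_measure.
Proof.
move=> A mA; rewrite ge0_fin_numE ?measure_ge0//.
apply: (@le_lt_trans _ _
  (lebesgue_measure (`[(0:R), 2 * trigo.pi] : set (measurableTypeR R)))).
  by apply: le_measure => //; rewrite inE//=; exact: measurableI.
by rewrite lebesgue_measure_itv/=; case: ifP => _; rewrite ltry.
Qed.

HB.instance Definition _ :=
  Measure_isFinite.Build _ _ _ circle_measure circle_fin.

Section step.
Variables (d : nat) (mu : {finite_measure set (torus R d) -> \bar R}).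

Definition torus_cons (p : measurableTypeR R * torus R d) : torus R d.+1 :=
  [tuple of p.1 :: p.2].

Lemma measurable_torus_cons : measurable_fun setT torus_cons.
Proof.
by apply: measurable_cons; [exact: measurable_fst|exact: measurable_snd].
Qed.

Definition torus_measureS : set (torus R d.+1) -> \bar R :=
  pushforward (circle_measure \x mu)%E torus_cons.

Let torus_measureS0 : torus_measureS set0 = 0%E.
Proof. by rewrite /torus_measureS /pushforward preimage_set0 measure0. Qed.

Let torus_measureS_ge0 A : (0 <= torus_measureS A)%E.
Proof. have mf := measurable_torus_cons; exact: measure_ge0. Qed.

Let torus_measureS_sigma_additive : semi_sigma_additive torus_measureS.
Proof.
have mf := measurable_torus_cons; exact: measure_semi_sigma_additive.
Qed.

HB.instance Definition _ := isMeasure.Build _ _ _ torus_measureS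
  torus_measureS0 torus_measureS_ge0 torus_measureS_sigma_additive.

Let torus_measureS_fin : fin_num_fun torus_measureS.
Proof.
move=> A mA; rewrite ge0_fin_numE//.
apply: (@le_lt_trans _ _ (torus_measureS setT)).
  by apply: le_measure; rewrite ?inE.
rewrite /torus_measureS /pushforward preimage_setT -setXTT product_measure1E//.
by rewrite lte_mul_pinfty// ?ge0_fin_numE//= -?ge0_fin_numE// fin_num_measure.
Qed.

HB.instance Definition _ :=
  Measure_isFinite.Build _ _ _ torus_measureS torus_measureS_fin.

End step.

(* Lebesgue measure of the part of a set lying in [0, 2 pi]^d, as an iterated
   product of one-dimensional measures *)
Fixpoint torus_measure (d : nat) : {finite_measure set (torus R d) -> \bar R} :=
  match d with
  | 0 => dirac ([tuple] : torus R 0)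
  | d'.+1 => torus_measureS (torus_measure d')
  end.

End torus_measure.
Arguments torus_measure : clear implicits.


Section complex_integral.
Context {R : realType} {d : nat}.
Notation mu := (torus_measure R d).
Implicit Types (f g : torus R d -> R[i]^o).

Definition complex_measurable f :=
  measurable_fun setT (fun x => Re (f x)) /\
  measurable_fun setT (fun x => Im (f x)).

Definition complex_integrable f :=
  mu.-integrable setT (fun x => (Re (f x))%:E) /\
  mu.-integrable setT (fun x => (Im (f x))%:E).

Definition complex_integral f : R[i] :=
  (\int[mu]_x Re (f x)) +i* (\int[mu]_x Im (f x)).

Definition square_integrable : {pred torus R d -> R[i]^o} := fun f =>
  `[< complex_measurable f /\
      (\int[mu]_x ((normc (f x)) ^+ 2)%:E < +oo)%E >].

Lemma normcE2 (z : R[i]) : normc z ^+ 2 = Re z ^+ 2 + Im z ^+ 2.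
Proof. by case: z => a b /=; rewrite sqr_sqrtr ?addr_ge0 ?sqr_ge0. Qed.

Lemma measurable_normc2 f :
  complex_measurable f -> measurable_fun setT (fun x => normc (f x) ^+ 2).
Proof.
move=> [mRe mIm]; under eq_fun do rewrite normcE2.
by apply: measurable_funD; apply: measurable_funX.
Qed.

Lemma complex_measurableM f g : complex_measurable f -> complex_measurable g ->
  complex_measurable (fun x => f x * g x).
Proof.
move=> [f1 f2] [g1 g2]; split.
- rewrite (_ : (fun x => _) =
    (fun x => Re (f x) * Re (g x) - Im (f x) * Im (g x))).
    by apply: measurable_funB; exact: measurable_funM.
  by apply/funext => x; case: (f x) (g x) => [? ?] [? ?].
- rewrite (_ : (fun x => _) =
    (fun x => Re (f x) * Im (g x) + Im (f x) * Re (g x))).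
    by apply: measurable_funD; exact: measurable_funM.
  by apply/funext => x; case: (f x) (g x) => [? ?] [? ?].
Qed.

Lemma complex_measurableD f g : complex_measurable f -> complex_measurable g ->
  complex_measurable (f + g).
Proof.
move=> [f1 f2] [g1 g2]; split.
- rewrite (_ : (fun x => _) = (fun x => Re (f x) + Re (g x))).
    exact: measurable_funD.
  by apply/funext => x; rewrite fctE; case: (f x) (g x) => [? ?] [? ?].
- rewrite (_ : (fun x => _) = (fun x => Im (f x) + Im (g x))).
    exact: measurable_funD.
  by apply/funext => x; rewrite fctE; case: (f x) (g x) => [? ?] [? ?].
Qed.

Lemma complex_measurable_cst (a : R[i]^o) :
  complex_measurable (fun _ : torus R d => a).
Proof. by split; exact: measurable_cst. Qed.


Lemma normc2D_le (z w : R[i]) :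
  normc (z + w) ^+ 2 <= 2 * normc z ^+ 2 + 2 * normc w ^+ 2.
Proof.
case: z w => [a b] [c e]; rewrite !normcE2/= -subr_ge0.
have -> : 2 * (a ^+ 2 + b ^+ 2) + 2 * (c ^+ 2 + e ^+ 2) -
  ((a + c) ^+ 2 + (b + e) ^+ 2) = (a - c) ^+ 2 + (b - e) ^+ 2.
  by ring.
by rewrite addr_ge0 ?sqr_ge0.
Qed.

Lemma square_integrableP f : reflect
  (complex_measurable f /\
   mu.-integrable setT (fun x => (normc (f x) ^+ 2)%:E))
  (f \in square_integrable).
Proof.
have eqI : (\int[mu]_x `|(normc (f x) ^+ 2)%:E| =
            \int[mu]_x (normc (f x) ^+ 2)%:E)%E.
  by apply: eq_integral => x _; rewrite gee0_abs// lee_fin sqr_ge0.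
apply: (iffP (asboolP _)) => -[mf If]; split => //.
  apply/integrableP; split; last by rewrite eqI.
  by apply/measurable_EFinP; exact: measurable_normc2.
by move: If => /integrableP[_]; rewrite eqI.
Qed.

Lemma square_integrable_submod_closed : submod_closed square_integrable.
Proof.
split.
  apply/asboolP; split; first exact: (complex_measurable_cst 0).
  rewrite integral0_eq ?ltry// => x _.
  by rewrite [X in normc X](_ : _ = 0)// Normc.normc0 expr0n.
move=> a f g /square_integrableP[mf If] /square_integrableP[mg Ig].
have mh : complex_measurable (a *: f + g).
  apply: complex_measurableD => //.
  exact: (complex_measurableM (complex_measurable_cst a)).
apply/square_integrableP; split => //.
pose B x := ((2 * normc a ^+ 2)%:E * (normc (f x) ^+ 2)%:E +
             2%:E * (normc (g x) ^+ 2)%:E)%E.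
apply: (@le_integrable _ _ _ mu setT measurableT _ B).
- by apply/measurable_EFinP; exact: measurable_normc2.
- move=> x _; rewrite /B -!EFinM -EFinD !abse_EFin lee_fin.
  rewrite ger0_norm ?sqr_ge0// ger0_norm; last first.
    have n0 (z : R[i]) : 0 <= normc z ^+ 2 := sqr_ge0 _.
    exact: addr_ge0 (mulr_ge0 (mulr_ge0 (ler0n _ _) (n0 _)) (n0 _))
                    (mulr_ge0 (ler0n _ _) (n0 _)).
  apply: le_trans (normc2D_le _ _) _.
  by rewrite lerD2r Normc.normcM exprMn mulrA.
- by apply: integrableD => //; exact: integrableZl.
Qed.

HB.instance Definition _ :=
  GRing.isSubmodClosed.Build _ _ square_integrable
    square_integrable_submod_closed.

End complex_integral.

Section L2.
Local Open Scope quotient_scope.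
Context {R : realType} {d : nat}.
Notation mu := (torus_measure R d).

Definition L2fun :=
  {f : torus R d -> R[i]^o | f \in (@square_integrable R d)}.
HB.instance Definition _ := SubType.on L2fun.
HB.instance Definition _ := [Choice of L2fun by <:].
HB.instance Definition _ := [SubChoice_isSubLmodule of L2fun by <:].

Definition ae_zero : {pred L2fun} := fun f =>
  `[< {ae mu, forall x, val f x = 0} >].

Lemma ae_zero_submod_closed : submod_closed ae_zero.
Proof.
split; first by apply/asboolP; apply: aeW => x.
move=> a f g /asboolP f0 /asboolP g0; apply/asboolP.
apply: filterS2 f0 g0 => x f0 g0.
rewrite [val _](_ : _ = a *: val f + val g); last by rewrite linearP.
by rewrite [LHS](_ : _ = a *: val f x + val g x)// f0 g0 scaler0 addr0.
Qed.

HB.instance Definition _ :=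
  GRing.isSubmodClosed.Build _ _ ae_zero ae_zero_submod_closed.
HB.instance Definition _ :=
  GRing.isZmodClosed.Build _ ae_zero (GRing.submod_closedB ae_zero_submod_closed).


Definition L2 := Quotient.quot ae_zero.
HB.instance Definition _ := GRing.Zmodule.on L2.
HB.instance Definition _ : EqQuotient L2fun (Quotient.equiv ae_zero) L2 :=
  EqQuotient.on L2.

Definition L2_scale (a : R[i]) (f : L2) : L2 := \pi_L2 (a *: repr f).
Lemma L2_scaleE a (f : L2fun) : L2_scale a (\pi_L2 f) = \pi_L2 (a *: f).
Proof.
apply/eqP; rewrite -Quotient.idealrBE -scalerBr rpredZ//.
by rewrite Quotient.idealrBE reprK.
Qed.

Let L2_scaleA a b (f : L2) : L2_scale a (L2_scale b f) = L2_scale (a * b) f.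
Proof. by rewrite -[f]reprK !L2_scaleE ?scalerA ?reprK. Qed.

Let L2_scale1 : left_id 1 L2_scale.
Proof. by move=> f; rewrite -[f]reprK L2_scaleE scale1r. Qed.

Let L2_scaleDr : right_distributive L2_scale +%R.
Proof.
move=> a f g; rewrite -[f]reprK -[g]reprK -raddfD/=.
by rewrite !L2_scaleE -raddfD scalerDr.
Qed.

Let L2_scaleDl f : {morph L2_scale^~ f : a b / a + b}.
Proof.
by move=> a b; rewrite -[f]reprK !L2_scaleE -raddfD scalerDl.
Qed.

HB.instance Definition _ := GRing.Zmodule_isLmodule.Build R[i] L2
  L2_scaleA L2_scale1 L2_scaleDr L2_scaleDl.

End L2.
Arguments L2fun : clear implicits.
Arguments L2 : clear implicits.

Section fourier.
Context {R : realType} {d : nat}.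
Local Open Scope quotient_scope.
Notation mu := (torus_measure R d).
Implicit Types (k : d.-tuple int).

Definition expi (t : R) : R[i] := cos t +i* sin t.

Definition torus_dot k (x : torus R d) : R :=
  \sum_(j < d) (tnth k j)%:~R * tnth x j.

Definition fourier_coef k (f : torus R d -> R[i]^o) : R[i] :=
  ((2 * trigo.pi) `^ (- (d%:R / 2)))%:C *
  complex_integral (fun x => f x * expi (- torus_dot k x)).

Definition L2_coef k (f : L2 R d) : R[i] := fourier_coef k (val (repr f)).

Lemma complex_measurable_expi k :
  complex_measurable (fun x : torus R d => expi (- torus_dot k x)).
Proof.
have mdot : measurable_fun setT (fun x : torus R d => - torus_dot k x).
  apply: measurable_funN; apply: measurable_sum => j.
  by apply: measurable_funM => //; exact: (measurable_tnth j).
split => /=; apply: (measurableT_comp _ mdot).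
  by apply: continuous_measurable_fun; exact: continuous_cos.
by apply: continuous_measurable_fun; exact: continuous_sin.
Qed.

Lemma complex_integrable_fourier k (f : torus R d -> R[i]^o) :
  f \in square_integrable ->
  complex_integrable (fun x => f x * expi (- torus_dot k x)).
Proof.
move=> /square_integrableP[mf If].
have [m1 m2] := complex_measurableM mf (complex_measurable_expi k).
have Ib : mu.-integrable setT (fun x => (1%:E + (normc (f x) ^+ 2)%:E)%E).
  by apply: integrableD => //; exact: finite_measure_integrable_cst.
have bnd x : normc (f x * expi (- torus_dot k x)) ^+ 2 = normc (f x) ^+ 2.
  rewrite Normc.normcM exprMn [X in _ * X]normcE2/= cos2Dsin2 mulr1//.
have le1 (a b : R) : `|a| <= 1 + (a ^+ 2 + b ^+ 2) /\
                     `|b| <= 1 + (a ^+ 2 + b ^+ 2).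
  by split; rewrite ler_norml; apply/andP; split; nra.
have n0 (x : torus R d) : 0 <= 1 + normc (f x) ^+ 2 :=
  addr_ge0 ler01 (sqr_ge0 _).
split; apply: le_integrable Ib => //.
- exact/measurable_EFinP.
- move=> x _; rewrite -EFinD !abse_EFin lee_fin (ger0_norm (n0 x)) -bnd normcE2.
  exact: (le1 _ _).1.
- exact/measurable_EFinP.
- move=> x _; rewrite -EFinD !abse_EFin lee_fin (ger0_norm (n0 x)) -bnd normcE2.
  exact: (le1 _ _).2.
Qed.

Lemma complex_integral_linear (a : R[i]) (f g : torus R d -> R[i]^o) :
  complex_integrable f -> complex_integrable g ->
  complex_integral (fun x => a * f x + g x) =
  a * complex_integral f + complex_integral g.
Proof.
move=> [f1 f2] [g1 g2]; case: a => a b.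
have iZ c (h : torus R d -> R) : mu.-integrable setT (EFin \o h) ->
    mu.-integrable setT (EFin \o (fun x => c * h x)).
  by move=> /(integrableZl measurableT c); apply: eq_integrable.
rewrite /complex_integral; apply/eqP; rewrite eq_complex/=; apply/andP; split; apply/eqP.
- transitivity (\int[mu]_x ((a * Re (f x) + (- b) * Im (f x)) + Re (g x))).
    apply: eq_Rintegral => x _.
    by case: (f x) (g x) => [? ?] [? ?] /=; rewrite mulNr.
  rewrite RintegralD//; last first.
    have := integrableD measurableT (iZ a _ f1) (iZ (- b) _ f2).
    exact: eq_integrable.
  rewrite RintegralD//; [|exact: iZ|exact: iZ].
  by rewrite RintegralZl// RintegralZl// mulNr.
- transitivity (\int[mu]_x ((a * Im (f x) + b * Re (f x)) + Im (g x))).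
    apply: eq_Rintegral => x _.
    by case: (f x) (g x) => [? ?] [? ?] /=.
  rewrite RintegralD//; last first.
    have := integrableD measurableT (iZ a _ f2) (iZ b _ f1).
    exact: eq_integrable.
  rewrite RintegralD//; [|exact: iZ|exact: iZ].
  by rewrite RintegralZl// RintegralZl.
Qed.

Lemma fourier_coef_linear k a (f g : L2fun R d) :
  fourier_coef k (val (a *: f + g)) =
  a * fourier_coef k (val f) + fourier_coef k (val g).
Proof.
have F := complex_integrable_fourier k (valP f).
have G := complex_integrable_fourier k (valP g).
rewrite /fourier_coef mulrCA -mulrDr; congr (_ * _).
rewrite -(complex_integral_linear a F G).
congr complex_integral; apply/funext => x.
by rewrite mulrA -mulrDl.
Qed.

Lemma fourier_coef_ae_zero k (f : L2fun R d) :
  f \in ae_zero -> fourier_coef k (val f) = 0.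
Proof.
move=> /asboolP f0.
have [m1 m2] := complex_integrable_fourier k (valP f).
have z0 (p : R[i] -> R) : p 0 = 0 ->
    mu.-integrable setT
      (fun x => (p (val f x * expi (- torus_dot k x)))%:E) ->
    \int[mu]_x p (val f x * expi (- torus_dot k x)) = 0.
  move=> p0 /integrableP[mp _]; rewrite /Rintegral.
  rewrite (ae_eq_integral (cst 0%E)) ?integral0//.
  by apply: filterS f0 => x fx0 _; rewrite fx0 mul0r p0.
by rewrite /fourier_coef /complex_integral !z0// mulr0.
Qed.

(* L2_coef does not depend on the representative *)
Lemma L2_coefE k (f : L2fun R d) :
  L2_coef k (\pi_(L2 R d) f) = fourier_coef k (val f).
Proof.
have : repr (\pi_(L2 R d) f) - f \in ae_zero.
  by rewrite Quotient.idealrBE reprK.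
move=> /(fourier_coef_ae_zero k) fg0; rewrite /L2_coef.
rewrite -[X in fourier_coef k (val X)](subrK f) -[X in X + f]scale1r.
by rewrite fourier_coef_linear fg0 mulr0 add0r.
Qed.

Lemma L2_coef_linear k a (f g : L2 R d) :
  L2_coef k (a *: f + g) = a * L2_coef k f + L2_coef k g.
Proof.
rewrite -[f]reprK -[g]reprK -[a *: _]/(L2_scale a _) L2_scaleE -raddfD/=.
by rewrite !L2_coefE fourier_coef_linear.
Qed.

End fourier.

Section L2_norm.
Context {R : realType} {d : nat}.
Local Open Scope quotient_scope.
Notation mu := (torus_measure R d).

Definition L2_norm (f : L2 R d) : R :=
  Num.sqrt (\int[mu]_x (normc (val (repr f) x)) ^+ 2).

(* L2_norm does not depend on the representative *)
Lemma L2_normE (f : L2fun R d) :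
  L2_norm (\pi_(L2 R d) f) = Num.sqrt (\int[mu]_x (normc (val f x)) ^+ 2).
Proof.
rewrite /L2_norm; congr Num.sqrt; rewrite /Rintegral; congr fine.
set g := repr _.
have /asboolP gf : g - f \in ae_zero by rewrite Quotient.idealrBE reprK.
have /square_integrableP[mf _] := valP f.
have /square_integrableP[mg _] := valP g.
apply: ae_eq_integral => //.
- by apply/measurable_EFinP; exact: measurable_normc2.
- by apply/measurable_EFinP; exact: measurable_normc2.
- apply: filterS gf => x gfx _; congr (normc _ ^+ 2)%:E.
  by apply/eqP; rewrite -subr_eq0; apply/eqP.
Qed.

End L2_norm.

Section Hmix.
Context {R : realType} {d : nat}.

(* the square of the norm of H^{s,#}_mix, possibly infinite *)
Definition Hmix_sqnorm (s : R) (f : L2 R d) : \bar R :=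
  \esum_(k in [set: d.-tuple int])
    (normc (L2_coef k f) ^+ 2 *
     \prod_(j < d) (1 + `|(tnth k j)%:~R|) `^ (2 * s))%:E.

Definition Hmix_pred (s : R) : {pred L2 R d} := fun f =>
  `[< (Hmix_sqnorm s f < +oo)%E >].

Lemma esumZ_le (I : choiceType) (c : R) (a : I -> \bar R) : 0 <= c ->
  (forall i, 0 <= a i)%E ->
  (\esum_(i in [set: I]) (c%:E * a i) <= c%:E * \esum_(i in [set: I]) a i)%E.
Proof.
move=> c0 a0; apply: ub_ereal_sup => _ [A [finA _] <-].
rewrite -ge0_mule_fsumr//; apply: lee_wpmul2l; first by rewrite lee_fin.
by apply: ereal_sup_ubound; exists A.
Qed.

Lemma Hmix_submod_closed s : submod_closed (Hmix_pred s).
Proof.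
have w0 (k : d.-tuple int) :
    0 <= \prod_(j < d) (1 + `|(tnth k j)%:~R : R|) `^ (2 * s).
  by apply: prodr_ge0 => j _; exact: powR_ge0.
have t0 f (k : d.-tuple int) : (0 <= (normc (L2_coef k f) ^+ 2 *
    \prod_(j < d) (1 + `|(tnth k j)%:~R : R|) `^ (2 * s))%:E)%E.
  by rewrite lee_fin; apply: mulr_ge0 (w0 k); exact: sqr_ge0.
split.
  apply/asboolP; rewrite /Hmix_sqnorm esum1 ?ltry// => k _.
  have /eqP := @L2_coef_linear R d k 1 0 0.
  rewrite addr0 scale1r mul1r eq_sym -subr_eq0 addrK => /eqP ->.
  by rewrite Normc.normc0 expr0n mul0r.
move=> a f g /asboolP f0 /asboolP g0; apply/asboolP.
pose B := (\esum_(k in [set: d.-tuple int])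
  ((2 * normc a ^+ 2)%:E * (normc (L2_coef k f) ^+ 2 *
     \prod_(j < d) (1 + `|(tnth k j)%:~R|) `^ (2 * s))%:E +
   2%:E * (normc (L2_coef k g) ^+ 2 *
     \prod_(j < d) (1 + `|(tnth k j)%:~R|) `^ (2 * s))%:E))%E.
have c0 : 0 <= 2 * normc a ^+ 2 by apply: mulr_ge0 => //; exact: sqr_ge0.
apply: (@le_lt_trans _ _ B).
  apply: le_esum => k _; rewrite -!EFinM -EFinD lee_fin.
  move: (w0 k); set w := \prod_(j < d) _ => wk0.
  rewrite !(mulrA _ _ w) -mulrDl; apply: ler_wpM2r => //.
  rewrite L2_coef_linear; apply: le_trans (normc2D_le _ _) _.
  by rewrite Normc.normcM exprMn mulrA.
rewrite /B esumD; last 2 first.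
- by move=> k _; rewrite mule_ge0// lee_fin.
- by move=> k _; rewrite mule_ge0// lee_fin.
apply: lte_add_pinfty; apply: le_lt_trans (esumZ_le _ _) _ => //.
- by apply: lte_mul_pinfty; rewrite ?lee_fin.
- by apply: lte_mul_pinfty; rewrite ?lee_fin.
Qed.

HB.instance Definition _ s :=
  GRing.isSubmodClosed.Build _ _ (Hmix_pred s) (Hmix_submod_closed s).

Definition Hmix (s : R) := {f : L2 R d | f \in Hmix_pred s}.
HB.instance Definition _ s := SubType.on (Hmix s).
HB.instance Definition _ s := [Choice of Hmix s by <:].
HB.instance Definition _ s := [SubChoice_isSubLmodule of Hmix s by <:].

Definition Hmix_norm s (f : Hmix s) : R :=
  Num.sqrt (fine (Hmix_sqnorm s (val f))).

Definition Hmix_embedding s : {linear Hmix s -> L2 R d} := val.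

End Hmix.
Arguments Hmix {R} d s.
Arguments Hmix_embedding {R} d s.

Section approximation_numbers.
Context {R : realType} {X Y : lmodType R[i]} (nX : X -> R) (nY : Y -> R).

Definition bounded_operator (T : X -> Y) :=
  exists C : R, forall x, nY (T x) <= C * nX x.

(* +oo when T is not bounded *)
Definition operator_norm (T : X -> Y) : \bar R :=
  ereal_sup [set (nY (T x))%:E | x in [set x | nX x <= 1]].

(* the range of T has a basis with m elements *)
Definition has_rank (T : X -> Y) (m : nat) :=
  exists e : 'I_m -> Y,
  [/\ forall i, range T (e i),
      forall c : 'I_m -> R[i], \sum_i c i *: e i = 0 -> forall i, c i = 0 &
      forall x, exists c : 'I_m -> R[i], T x = \sum_i c i *: e i].

Definition approximation_number (T : {linear X -> Y}) (n : nat) : \bar R :=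
  ereal_inf [set operator_norm (fun x => T x - A x) |
    A in [set A : {linear X -> Y} | bounded_operator A /\
                                    exists2 m, (m < n)%N & has_rank A m]].

End approximation_numbers.

Definition log2 {R : realType} (x : R) : R := ln x / ln 2.

Definition alpha {R : realType} (n d : nat) : R :=
  2 + log2 (d%:R / log2 n%:R + 2^-1).

(* Main.v *)
(** The n-th approximation number is at least [r^-s] as soon as n distinct
frequencies k satisfy [prod_j (1 + |k_j|) <= r]: an operator of rank below n
kills a nonzero f in the span of the n exponentials, and on that span the
[H^s_mix] norm is at most [r^s] times the [L_2] norm.

To count frequencies, let N(d, l) be the cardinality of a recursively built set
of k with [prod_j (1 + |k_j|) <= 2^l], satisfying the Pascal-type rule
[N(d+1, l+1) = N(d, l+1) + 2 N(d+1, l)]; it is at least [2^l C(d+l-1, l)]. With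
m such that [N(d, m) < n <= N(d, m+1)], the radius is [r = 2^(m+1)] and there
remains [m alpha(n, d) <= log2 n]. The assumption [n <= (d/2) 4^d <= N(d, d)]
gives [m < d], hence [4^m <= N(d, m) < n], so that [log2 n >= 2m] and
[alpha(n, d) <= log2 (2 (d + m) / m)]; the claim becomes
[2^m (m + d)^m <= n m^m], a lower bound for N(d, m) + 1. *)

Require Import Defs.
From mathcomp Require Import all_boot all_order all_algebra.
From mathcomp Require Import zify ring lra.
From mathcomp Require Import generic_quotient ring_quotient complex.
From mathcomp Require Import all_classical all_reals all_analysis.
From mathcomp Require Import measurable_realfun.

Set Implicit Arguments.
Unset Strict Implicit.
Unset Printing Implicit Defensive.

Import Order.TTheory GRing.Theory Num.Theory.
Import numFieldNormedType.Exports.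

(** * Counting frequencies *)

Section dyadic_points.
Local Open Scope nat_scope.

(* Injective maps with disjoint ranges that avoid 0 and at most double
   [1 + |k|]: applied to the head, they let the recursive call of
   [dyadic_points] in the same dimension contribute twice. *)
Definition double_odd (k : int) : int :=
  (if 0 <= k then 2 * k + 1 else 2 * k - 1)%R.
Definition double_even (k : int) : int := (if k == 0 then -1 else 2 * k)%R.

Definition map_head (g : int -> int) d (t : d.+1.-tuple int) :
  d.+1.-tuple int :=
  [tuple of g (thead t) :: behead_tuple t].

(** The list leaves out some tuples within the weight bound, such as (2, 4) of weight 15 at level 4.
    In return its size satisfies an exact recursion in [d] and [l]. *)
Fixpoint dyadic_points (d : nat) : nat -> seq (d.-tuple int) :=
  match d with
  | 0 => fun _ => [:: [tuple]]
  | d'.+1 => fix points l :=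
    match l with
    | 0 => [seq [tuple of 0%R :: t] | t : d'.-tuple int <- dyadic_points d' 0]
    | l'.+1 =>
        [seq [tuple of 0%R :: t] | t : d'.-tuple int <- dyadic_points d' l] ++
        map (@map_head double_odd d') (points l') ++
        map (@map_head double_even d') (points l')
    end
  end.

Local Notation npoints d l := (size (dyadic_points d l)).

Lemma map_head_inj (g : int -> int) d :
  injective g -> injective (@map_head g d).
Proof.
move=> gI t u; case/tupleP: t => x t; case/tupleP: u => y u.
move=> /(congr1 val) /= [] /gI; rewrite /thead !tnth0 => -> E.
by apply/val_inj; rewrite /= E.
Qed.

(** The head tells the three blocks of a level apart: it is zero, or lies in one of the two disjoint
    ranges. *)
Lemma dyadic_points_uniq d l : uniq (dyadic_points d l).
Proof.
have cons0I e : injective (fun t : e.-tuple int => [tuple of 0%R :: t]).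
  by move=> t u /(congr1 val) [] /val_inj.
elim: d l => [|d IHd] //; elim=> [|l IHl].
  by rewrite /= map_inj_uniq//; exact: cons0I.
have oddI : injective double_odd.
  by rewrite /double_odd => x y; do 2 case: ifP; lia.
have evenI : injective double_even.
  by rewrite /double_even => x y; do 2 case: ifP; lia.
have odd0 x : double_odd x <> 0%R by rewrite /double_odd; case: ifP; lia.
have even0 x : double_even x <> 0%R by rewrite /double_even; case: ifP; lia.
have odd_even x y : double_odd x <> double_even y.
  by rewrite /double_odd /double_even; do 2 case: ifP; lia.
rewrite /= -/(dyadic_points d.+1 l) !cat_uniq (map_inj_uniq (@cons0I d)).
rewrite !map_inj_uniq; [|exact: map_head_inj..].
rewrite IHd IHl /= andbT; apply/andP; split; apply/hasPn => t.
  rewrite mem_cat => tP; apply/negP => /mapP[u _ tE].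
  have {tE} : thead t = 0%R by rewrite tE.
  case/orP: tP => /mapP[v _ ->]; rewrite /thead tnth0; first exact: odd0.
  exact: even0.
move=> /mapP[u _ ->]; apply/negP => /mapP[v _] /(congr1 (@thead _ _)).
by rewrite /thead !tnth0 => /esym; exact: odd_even.
Qed.

(** A zero head contributes the factor 1; changing the head by either map costs at most a factor 2,
    paid for by one level. *)
Lemma dyadic_points_weight d l (k : d.-tuple int) : k \in dyadic_points d l ->
  \prod_(j < d) (1 + `|tnth k j|%N) <= 2 ^ l.
Proof.
elim: d l k => [|d IHd] l k; first by rewrite big_ord0 expn_gt0.
have cons0 l' :
    k \in [seq [tuple of 0%R :: t] | t : d.-tuple int <- dyadic_points d l'] ->
    \prod_(j < d.+1) (1 + `|tnth k j|%N) <= 2 ^ l'.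
  move=> /mapP[t /IHd tl ->]; rewrite big_ord_recl tnth0 mul1n.
  by under eq_bigr do rewrite tnthS.
elim: l k cons0 => [|l IHl] k cons0 /=; first exact: cons0.
have head g : (forall x : int, 1 + `|g x|%N <= 2 * (1 + `|x|%N)) ->
    k \in map (@map_head g d) (dyadic_points d.+1 l) ->
    \prod_(j < d.+1) (1 + `|tnth k j|%N) <= 2 ^ l.+1.
  move=> gle /mapP[t tl ->].
  have {tl}: \prod_(j < d.+1) (1 + `|tnth t j|%N) <= 2 ^ l.
    apply: IHl tl => l' /mapP[u /IHd ul ->].
    rewrite big_ord_recl tnth0 mul1n.
    by under eq_bigr do rewrite tnthS.
  case/tupleP: t => x t; rewrite !big_ord_recl !tnth0 /thead tnth0 => tl.
  under eq_bigr do rewrite tnthS.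
  rewrite expnS; apply: leq_trans (leq_mul (leqnn 2) tl); rewrite mulnA.
  apply: leq_mul; first exact: gle.
  apply: eq_leq; apply: eq_bigr => i _.
  by rewrite tnthS [tnth _ _](tnth_nth 0%R) (tnth_nth 0%R).
rewrite !mem_cat => /or3P[|/head|/head]; first exact: cons0.
- by apply=> x; rewrite /double_odd; case: ifP; lia.
- by apply=> x; rewrite /double_even; case: ifP; lia.
Qed.

(** * Lower bounds for the number of points *)

Lemma npoints0r d : npoints d 0 = 1.
Proof. by elim: d => //= d IH; rewrite size_map. Qed.

Lemma npointsS d l : npoints d.+1 l.+1 = npoints d l.+1 + 2 * npoints d.+1 l.
Proof.
by rewrite /= !size_cat !size_map -/(dyadic_points d.+1 l) addnn mul2n.
Qed.

Lemma npoints1r d : npoints d 1 = 1 + 2 * d.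
Proof. by elim: d => // d IH; rewrite npointsS npoints0r IH; lia. Qed.

Lemma npoints2r d : npoints d 2 = 1 + 4 * d + 2 * d ^ 2.
Proof. by elim: d => // d IH; rewrite npointsS npoints1r IH; lia. Qed.

(** The left side obeys the same recursion as [npointsS], by Pascal's rule. *)
Lemma npoints_ge_bin d l : 2 ^ l * 'C(d + l, l) <= npoints d.+1 l.
Proof.
elim: d l => [|d IHd]; elim=> [|l IHl]; rewrite ?npoints0r ?bin0 ?expn0//.
  by move: IHl; rewrite npointsS !add0n !binn !muln1 expnS; lia.
rewrite npointsS addnS binS mulnDr leq_add//.
  by rewrite addSnnS.
by rewrite expnS -mulnA leq_mul2l IHl.
Qed.

(** The two terms of Pascal's rule agree by symmetry. *)
Lemma bin_central_half m : 'C(m.+1 + m.+1, m.+1) = 2 * 'C(m + m.+1, m.+1).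
Proof.
rewrite addSn binS mul2n -addnn; congr (_ + _).
by rewrite -(bin_sub (leq_addl m m.+1)) addnK.
Qed.

Lemma bin_central_rec m :
  m.+1 * 'C(m.+1 + m.+1, m.+1) = 2 * (m + m).+1 * 'C(m + m, m).
Proof.
rewrite bin_central_half mulnCA addnS -mulnA; congr (2 * _).
by rewrite -mul_bin_diag.
Qed.

Lemma expn2_leq_bin m : 2 ^ m <= 'C(m + m, m).
Proof.
elim: m => // m IH; rewrite bin_central_half expnS leq_mul2l addnS binS.
by apply: leq_trans IH _; rewrite leq_addl.
Qed.

(** The bound fails at m = 3 (24 against 20) and starts at m = 4 with 64 <= 70; the induction step
    reduces to (m + 1)^2 <= m (2m + 1). *)
Lemma muln_expn2_leq_bin m : 3 < m -> m * 2 ^ m <= 'C(m + m, m).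
Proof.
elim: m => // m IH; rewrite ltnS leq_eqVlt => /predU1P[<-|m3]; first by [].
have {}IH := IH m3.
rewrite -(leq_pmul2l (ltn0Sn m)) bin_central_rec.
apply: leq_trans (leq_mul (leqnn _) IH); rewrite expnS !mulnA leq_mul2r.
by apply/orP; right; nia.
Qed.

(** For d >= 4, twice the bound 2^d C(2d - 1, d) is 2^d C(2d, d), and the central coefficient is at
    least d 2^d. The cases d = 2 and d = 3 are computed. *)
Lemma npoints_diag d : 1 < d -> d * 4 ^ d <= 2 * npoints d d.
Proof.
case: d => // d d1; have [d3|d3] := ltnP 3 d.+1; last first.
  by case: d d1 d3 => // -[|[|//]] _ _; [rewrite npoints2r|].
apply: leq_trans (leq_mul (leqnn 2) (npoints_ge_bin d d.+1)).
rewrite mulnCA -bin_central_half (expnMn 2 2) mulnCA leq_mul2l.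
by rewrite muln_expn2_leq_bin ?orbT.
Qed.

Lemma prod_rising d m : (\prod_(i < m) (d.+1 + i)) = 'C(d + m, m) * m`!.
Proof.
have F : (\prod_(i < m) (d.+1 + i)) * d`! = (d + m)`!.
  elim: m => [|m IH]; first by rewrite big_ord0 mul1n addn0.
  by rewrite big_ord_recr /= mulnAC IH mulnC addnS addSn factS.
apply/eqP; rewrite -(eqn_pmul2r (fact_gt0 d)) F -mulnA.
by rewrite -(bin_fact (leq_addl d m)) addnK.
Qed.

Lemma expn_leq_bin d m : 2 < m -> m <= d.+1 ->
  (m + d.+1) ^ m <= 'C(d + m, m) * m ^ m.
Proof.
(* Multiplied by m!, both sides become products over i < m. *)
move=> m2 md; rewrite -(leq_pmul2r (fact_gt0 m)) mulnAC -prod_rising.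
have -> : m`! = \prod_(i < m) i.+1 by rewrite fact_prod big_add1 big_mkord.
have expE a : a ^ m = \prod_(i < m) a by rewrite prod_nat_const card_ord.
rewrite !expE -!big_split /=; case: m m2 md {expE} => // -[//|p] p0 pd.
(* With [d' = d + 1], [(m + d') (i + 1) <= m (d' + i)] fails only for the last
   factor [i = m - 1], whose loss is made up for by the first one. *)
have split_ends (F : nat -> nat) :
    \prod_(i < p.+2) F i = F 0 * (\prod_(i < p) F i.+1) * F p.+1.
  by rewrite big_ord_recr big_ord_recl.
rewrite (split_ends (fun i => (p.+2 + d.+1) * i.+1)).
rewrite (split_ends (fun i => (d.+1 + i) * p.+2)).
set A := \prod_(i < p) _; set B := \prod_(i < p) _.
have AB : A <= B.
  by apply: leq_prod => i _; have := ltn_ord i; nia.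
(* The two end factors together: with m = p + 2 and d' = d + 1 this is (m + d')^2 <= d' m (d' + m -
   1), which holds for 3 <= m <= d' but fails at m = d' = 2. *)
suff : (p.+2 + d.+1) * (p.+2 + d.+1) * p.+2 <=
    d.+1 * p.+2 * (d.+1 + p.+1) * p.+2.
  by nia.
rewrite leq_mul2r; apply/orP; right; nia.
Qed.

(** The successor cannot be dropped: for m = 1 both sides equal 2 (d + 1). *)
Lemma npoints_ge_expn d m : m < d ->
  2 ^ m * (m + d) ^ m <= (npoints d m).+1 * m ^ m.
Proof.
(* For [m = 1] and [m = 2] the bound [npoints_ge_bin] is too weak. *)
case: d => // d md; case: m md => [//|[|[|m]]] md.
- by rewrite npoints1r; lia.
- by rewrite npoints2r; nia.
apply: leq_trans (_ : npoints d.+1 m.+3 * m.+3 ^ m.+3 <= _); last first.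
  by rewrite leq_mul2r leqnSn orbT.
apply: leq_trans (leq_mul (npoints_ge_bin d m.+3) (leqnn _)).
by rewrite -mulnA leq_mul2l expn_leq_bin ?orbT// ltnW.
Qed.

(** As m <= d - 1, the coefficient C(d - 1 + m, m) dominates the central one C(2m, m), which is at
    least 2^m. *)
Lemma npoints_ge_expn4 d m : m < d -> 4 ^ m <= npoints d m.
Proof.
case: d => // d md; apply: leq_trans (npoints_ge_bin d m).
rewrite (expnMn 2 2) leq_mul2l; apply/orP; right.
apply: leq_trans (expn2_leq_bin m) _.
by rewrite leq_bin2l// leq_add2r.
Qed.

Lemma exists_dyadic_level d n : 1 < d -> 1 < n -> 2 * n <= d * 4 ^ d ->
  exists m, [/\ n <= npoints d m.+1, 4 ^ m <= n &
                2 ^ m * (m + d) ^ m <= n * m ^ m].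
Proof.
move=> d1 n1 nd; have nS : exists l, n <= npoints d l.
  by exists d; rewrite -(leq_pmul2l (ltn0Sn 1)) (leq_trans nd) ?npoints_diag.
(* The least level holding n points is positive, since level 0 holds only one. Its predecessor m has
   fewer than n points, which absorbs the successor in [npoints_ge_expn]. *)
case: (ex_minnP nS) => -[|m] nm mmin.
  by rewrite npoints0r leqNgt n1 in nm.
have md : m < d.
  by apply: mmin; rewrite -(leq_pmul2l (ltn0Sn 1)) (leq_trans nd) ?npoints_diag.
have Sm : npoints d m < n by rewrite ltnNge; apply/negP => /mmin; rewrite ltnn.
exists m; split=> //.
  exact: leq_trans (npoints_ge_expn4 md) (ltnW Sm).
by apply: leq_trans (npoints_ge_expn md) _; rewrite leq_mul2r Sm orbT.
Qed.

End dyadic_points.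

Local Open Scope classical_set_scope.
Local Open Scope ring_scope.
Local Open Scope complex_scope.

Local Notation torus R d := (d.-tuple (measurableTypeR R)).
Local Notation Re := complex.Re.
Local Notation Im := complex.Im.
Local Notation normc := Normc.normc.

(** * Exponentials on the torus *)

Lemma sin_periodz (R : realType) (k : int) (c : R) :
  sin (k%:~R * (2 * pi) + c) = sin c.
Proof.
have H n (x : R) : sin (n%:R * (2 * pi) + x) = sin x.
  have -> : n%:R * (2 * pi) = (pi *+ 2) *+ n :> R.
    by rewrite mulr_natl [2 * pi]mulr_natl.
  by rewrite addrC periodicn//; exact: sinD2pi.
case: k => n; first exact: H.
rewrite NegzE mulrNz mulNr -(H n.+1 (- _ + c)) addrA subrr add0r//.
Qed.

(** The complement of [D] is null for the restricted measure, and inside [D] the two measures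
    agree. *)
Lemma integral_mrestr d (T : measurableType d) (R : realType)
  (mu : {measure set T -> \bar R}) (D : set T) (mD : measurable D)
  (f : T -> \bar R) :
  (mrestr mu mD).-integrable setT f ->
  (\int[mrestr mu mD]_x f x = \int[mu]_(x in D) f x)%E.
Proof.
move=> fi; rewrite (@negligible_integral _ _ _ _ setT (~` D))//.
- rewrite setDE setCK setTI; apply: eq_measure_integral => A mA AD.
  by rewrite -[LHS]/(mu (A `&` D)) setIidl.
- exact: measurableC.
- by rewrite -[LHS]/(mu (~` D `&` D)) setICl measure0.
Qed.

Lemma integrable_cos d (T : measurableType d) (R : realType)
  (mu : {measure set T -> \bar R}) (f : T -> R) : (mu setT < +oo)%E ->
  measurable_fun setT f -> mu.-integrable setT (fun x => (cos (f x))%:E).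
Proof.
move=> mufin mf.
apply: (@measurable_bounded_integrable _ _ _ mu (fun x => cos (f x))) => //.
- apply: (measurableT_comp _ mf).
  by apply: continuous_measurable_fun; exact: continuous_cos.
- exists 1; split => // M M1 x _ /=; apply: le_trans (ltW M1).
  by rewrite ler_norml cos_geN1 cos_le1.
Qed.

Lemma fin_measure_lty d (T : measurableType d) (R : realType)
  (mu : {finite_measure set T -> \bar R}) : (mu setT < +oo)%E.
Proof. by rewrite -ge0_fin_numE// fin_num_measure. Qed.

(** The phase [c] will hold the contribution of the other coordinates. For k <> 0 the antiderivative
    sin(kx + c) / k takes the same value at both endpoints. *)
Lemma Rintegral_circle_cos (R : realType) (k : int) (c : R) :
  \int[@circle_measure R]_x cos (k%:~R * x + c) =
  (k == 0)%:R * (2 * pi) * cos c.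
Proof.
have [->|k0] := eqVneq k 0.
  under eq_Rintegral do rewrite mul0r add0r.
  rewrite mul1r /Rintegral integral_cst// fineM//=; last first.
    exact: fin_num_measure.
  rewrite mulrC; congr (_ * _).
  rewrite /circle_measure /mrestr setTI lebesgue_measure_itv/= lte_fin.
  by rewrite mulr_gt0 ?pi_gt0//= oppr0 addr0.
have kR : k%:~R != 0 :> R by rewrite intr_eq0.
have cf : continuous (fun x : R => cos (k%:~R * x + c)).
  move=> x; apply: continuous_comp; last exact: continuous_cos.
  by apply: cvgD; [apply: cvgMr|]; exact: cvg_cst || exact: cvg_id.
have D (x : R) : is_derive x 1 (fun x => k%:~R^-1 * sin (k%:~R * x + c))
    (cos (k%:~R * x + c)).
  apply: is_derive_eq; rewrite addr0 /GRing.scale/= mulr1.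
  by rewrite mulrCA mulVf// mulr1.
have cF : continuous (fun x : R => k%:~R^-1 * sin (k%:~R * x + c)).
  move=> x; apply: differentiable_continuous; apply/derivable1_diffP.
  exact: ex_derive.
rewrite mul0r mul0r /Rintegral integral_mrestr; last first.
  apply: (integrable_cos (fin_measure_lty (@circle_measure R))).
  by apply: measurable_funD => //; exact: measurable_funM.
rewrite [X in fine X](@continuous_FTC2 _ (fun x => cos (k%:~R * x + c))
  (fun x => k%:~R^-1 * sin (k%:~R * x + c)) 0 (2 * pi)) ?mulr_gt0 ?pi_gt0//.
- by rewrite sin_periodz mulr0 add0r subee.
- exact/continuous_subspaceT.
- split; first by move=> x _; exact: ex_derive.
  + by apply: cvg_at_right_filter; exact: cF.
  + by apply: cvg_at_left_filter; exact: cF.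
- by move=> x _; rewrite derive1E derive_val.
Qed.

Lemma measurable_torus_dot (R : realType) d (k : d.-tuple int) (c : R) :
  measurable_fun setT (fun x : torus R d => torus_dot k x + c).
Proof.
apply: measurable_funD => //; apply: measurable_sum => j.
by apply: measurable_funM => //; exact: (measurable_tnth j).
Qed.

(** Integrating out the first coordinate leaves a multiple of a cosine in the remaining ones, so the
    induction closes with an arbitrary phase. *)
Lemma Rintegral_torus_cos (R : realType) d (k : d.-tuple int) (c : R) :
  \int[torus_measure R d]_x cos (torus_dot k x + c) =
  (k == [tuple of nseq d 0])%:R * (2 * pi) ^+ d * cos c.
Proof.
elim: d k c => [|d IH] k c.
  rewrite /= /Rintegral integral_dirac//; last first.
    apply/measurable_EFinP.
    apply: (measurableT_comp _ (measurable_torus_dot _ _)).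
    by apply: continuous_measurable_fun; exact: continuous_cos.
  have -> : k == [tuple of nseq 0 0].
    by rewrite [k]tuple0 eq_sym [X in X == _]tuple0.
  by rewrite diracT mul1e /torus_dot big_ord0 add0r !mul1r.
case/tupleP: k => k0 k.
have dotS (x : R) (y : torus R d) :
    torus_dot [tuple of k0 :: k] (torus_cons (x, y)) + c =
    k0%:~R * x + (torus_dot k y + c).
  rewrite /torus_dot big_ord_recl !tnth0 addrA; congr (_ + _ + _).
  by apply: eq_bigr => i _; rewrite !tnthS.
(* Change of variables along [torus_cons], then Fubini with the first coordinate innermost. *)
transitivity (\int[torus_measure R d]_y \int[@circle_measure R]_x
    cos (k0%:~R * x + (torus_dot k y + c))).
  rewrite /Rintegral; congr fine.
  have mtc := @measurable_torus_cons R d.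
  have mcos := measurableT_comp (measurable_torus_dot [tuple of k0 :: k] c) mtc.
  have prodfin : ((@circle_measure R \x torus_measure R d) setT < +oo)%E.
    rewrite -setXTT product_measure1E// lte_mul_pinfty//.
      exact: (fin_num_measure (@circle_measure R)).
    exact: fin_measure_lty.
  have icos := integrable_cos prodfin mcos.
  rewrite [LHS](integral_pushforward mtc _ icos measurableT); last first.
    apply/measurable_EFinP.
    apply: (measurableT_comp _ (measurable_torus_dot _ _)).
    by apply: continuous_measurable_fun; exact: continuous_cos.
  rewrite preimage_setT -[LHS](integral21_prod_meas1 icos).
  apply: eq_integral => y _; rewrite /fubini_G /=.
  under eq_integral do rewrite dotS.
  rewrite fineK//; apply: integrable_fin_num => //.
  apply: (integrable_cos (fin_measure_lty (@circle_measure R))).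
  by apply: measurable_funD => //; exact: measurable_funM.
under eq_Rintegral do rewrite Rintegral_circle_cos.
rewrite RintegralZl//; last first.
  exact: (integrable_cos (fin_measure_lty _) (measurable_torus_dot k c)).
have -> : ([tuple of k0 :: k] == [tuple of nseq d.+1 0]) =
    (k0 == 0) && (k == [tuple of nseq d 0]) by rewrite -!val_eqE /= eqseq_cons.
rewrite IH exprS -mulnb natrM -!mulrA; congr (_ * _).
by rewrite [RHS]mulrCA; congr (_ * _); rewrite mulrCA.
Qed.

Section complex_integral_sum.
Context {R : realType} {d : nat}.
Notation mu := (torus_measure R d).

Lemma complex_integrable_linear (a : R[i]) (f g : torus R d -> R[i]^o) :
  complex_integrable f -> complex_integrable g ->
  complex_integrable (fun x => a * f x + g x).
Proof.
move=> [f1 f2] [g1 g2]; case: a => a b.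
have iZ c (h : torus R d -> R) : mu.-integrable setT (EFin \o h) ->
    mu.-integrable setT (EFin \o (fun x => c * h x)).
  by move=> /(integrableZl measurableT c); apply: eq_integrable.
split.
- have := integrableD measurableT
    (integrableD measurableT (iZ a _ f1) (iZ (- b) _ f2)) g1.
  apply: eq_integrable => // x _ /=.
  by case: (f x) (g x) => [? ?] [? ?] /=; rewrite mulNr.
- have := integrableD measurableT
    (integrableD measurableT (iZ a _ f2) (iZ b _ f1)) g2.
  apply: eq_integrable => // x _ /=.
  by case: (f x) (g x) => [? ?] [? ?] /=.
Qed.

Lemma complex_integral_sum (I : Type) (r : seq I) (a : I -> R[i])
    (f : I -> torus R d -> R[i]^o) :
  (forall i, complex_integrable (f i)) ->
  complex_integral (fun x => \sum_(i <- r) a i * f i x) =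
  \sum_(i <- r) a i * complex_integral (f i).
Proof.
(* Integrability of the partial sums goes through the induction too, as linearity of the integral
   requires it. *)
move=> fi; suff [] : complex_integrable (fun x => \sum_(i <- r) a i * f i x) /\
    complex_integral (fun x => \sum_(i <- r) a i * f i x) =
    \sum_(i <- r) a i * complex_integral (f i) by [].
elim: r => [|i r [IHi IH]].
  split.
    by split; under eq_fun do rewrite big_nil; exact: integrable0.
  rewrite big_nil /complex_integral.
  under eq_Rintegral do rewrite big_nil.
  under [X in _ +i* X]eq_Rintegral do rewrite big_nil.
  by rewrite /Rintegral integral0.
under eq_fun do rewrite big_cons.
split; first exact: complex_integrable_linear.
by rewrite complex_integral_linear// IH big_cons.
Qed.

End complex_integral_sum.

Section characters.
Context {R : realType} {d : nat}.
Implicit Types k l : d.-tuple int.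
Local Open Scope quotient_scope.

(** Normalised in L_2, so that its Fourier coefficients are Kronecker deltas. *)
Definition torus_char k (x : torus R d) : R[i]^o :=
  ((2 * trigo.pi) `^ (- (d%:R / 2)))%:C * expi (torus_dot k x).

Lemma torus_char_square_integrable k : torus_char k \in square_integrable.
Proof.
apply/square_integrableP; split.
  apply: complex_measurableM; first exact: complex_measurable_cst.
  have mdot : measurable_fun setT (torus_dot k : torus R d -> R).
    by have := measurable_torus_dot k (0 : R); under eq_fun do rewrite addr0.
  split => /=; apply: (measurableT_comp _ mdot).
    by apply: continuous_measurable_fun; exact: continuous_cos.
  by apply: continuous_measurable_fun; exact: continuous_sin.
have nE x : normc (torus_char k x) ^+ 2 =
    normc ((2 * trigo.pi) `^ (- (d%:R / 2)))%:C ^+ 2 :> R.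
  by rewrite Normc.normcM exprMn [X in _ * X]normcE2/= cos2Dsin2 mulr1.
under eq_fun do rewrite nE.
exact: finite_measure_integrable_cst.
Qed.

Definition torus_char_L2fun k : L2fun R d :=
  Sub (torus_char k) (torus_char_square_integrable k).

Lemma fourier_coef_torus_char k l : fourier_coef l (torus_char k) = (l == k)%:R.
Proof.
pose m : d.-tuple int := [tuple tnth k j - tnth l j | j < d].
have mE : (m == [tuple of nseq d 0]) = (l == k).
  apply/eqP/eqP => [m0|lk].
    apply/eq_from_tnth => j; apply/esym/eqP; rewrite -subr_eq0.
    have := congr1 (fun t : d.-tuple int => tnth t j) m0.
    by rewrite tnth_mktuple => ->; rewrite (tnth_nth 0) nth_nseq ltn_ord.
  rewrite /m lk; apply/eq_from_tnth => j.
  by rewrite tnth_mktuple subrr (tnth_nth 0) nth_nseq ltn_ord.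
pose A : R := (2 * trigo.pi) `^ (- (d%:R / 2)).
(* The sine is written as a cosine shifted by pi/2, so that [Rintegral_torus_cos] serves for both
   parts. *)
have fE x : torus_char k x * expi (- torus_dot l x) =
    (A * cos (torus_dot m x + 0)) +i* (A * cos (torus_dot m x + - (pi / 2))).
  have -> : torus_dot m x = torus_dot k x - torus_dot l x.
    rewrite /torus_dot -sumrB; apply: eq_bigr => j _.
    by rewrite tnth_mktuple rmorphB mulrBl.
  rewrite cosBpihalf /torus_char -mulrA -/A.
  apply/eqP; rewrite eq_complex/= !cosD !sinD !cosN !sinN cos0 sin0.
  by apply/andP; split; apply/eqP; ring.
have ci c := integrable_cos (fin_measure_lty (torus_measure R d))
  (measurable_torus_dot m c).
rewrite /fourier_coef /complex_integral -/A.
under eq_Rintegral do rewrite fE.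
under [X in _ +i* X]eq_Rintegral do rewrite fE.
rewrite /= !RintegralZl//; [|exact: ci..].
rewrite !Rintegral_torus_cos cosN cos_pihalf !mulr0 cos0 mulr1 mE.
(* The normalising factors of the exponential and of the Fourier coefficient cancel the volume of
   the torus. *)
have A2 : A * A * (2 * pi) ^+ d = 1.
  have p0 : 0 < 2 * pi :> R by rewrite mulr_gt0// pi_gt0.
  rewrite /A -powRD ?(gt_eqF p0) ?implybT// -opprD -splitr.
  rewrite powRN powR_mulrn ?ltW//.
  by rewrite mulVf// expf_neq0// gt_eqF.
apply/eqP; rewrite eq_complex/=; apply/andP; split; apply/eqP; last first.
  by case: (l == k); rewrite /=; ring.
case: (l == k) => /=; rewrite ?mulr0 ?mul0r ?subr0 ?mulr0//.
by rewrite mul1r mulrA.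
Qed.

Lemma L2_coef_torus_char k l :
  L2_coef l (\pi_(L2 R d) (torus_char_L2fun k)) = (l == k)%:R.
Proof. by rewrite L2_coefE fourier_coef_torus_char. Qed.

End characters.

(** * Norms of trigonometric polynomials *)

Lemma esum_seq_support (R : realType) (T : choiceType) (r : seq T)
    (a : T -> \bar R) :
  uniq r -> (forall i, 0 <= a i)%E -> (forall i, i \notin r -> a i = 0%E) ->
  (\esum_(i in [set: T]) a i = \sum_(i <- r) a i)%E.
Proof.
move=> ur a0 ar; rewrite fsbig_seq// -esum_fset// [RHS]esum_mkcond.
apply: eq_esum => i _; case: ifPn => //.
by rewrite notin_setE /= => /negP; exact: ar.
Qed.

Lemma normc_sqr (R : realType) (z : R[i]) : normc z ^+ 2 = Re (z * z^*).
Proof. by rewrite normcE2; case: z => a b /=; ring. Qed.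

Lemma powR_prod (R : realType) (I : Type) (r : seq I) (a : I -> R) (p : R) :
  (forall i, 0 <= a i) ->
  \prod_(i <- r) a i `^ p = (\prod_(i <- r) a i) `^ p.
Proof.
move=> a0; elim: r => [|i r IH]; first by rewrite !big_nil powR1.
by rewrite !big_cons IH powRM// prodr_ge0.
Qed.

Section span.
Context {R : realType} {d n : nat}.
Context (k : 'I_n -> d.-tuple int) (c : 'I_n -> R[i]).
Hypothesis k_inj : injective k.
Local Open Scope quotient_scope.

Definition char_sum : L2 R d :=
  \sum_i c i *: \pi_(L2 R d) (torus_char_L2fun (k i)).

Lemma char_sumE :
  char_sum = \pi_(L2 R d) (\sum_i c i *: torus_char_L2fun (k i)).
Proof.
rewrite raddf_sum; apply: eq_bigr => i _.
by rewrite -[LHS]/(L2_scale _ _) L2_scaleE.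
Qed.

Lemma L2_coef_char_sum l : L2_coef l char_sum = \sum_i c i * (l == k i)%:R.
Proof.
have L0 : L2_coef l (0 : L2 R d) = 0.
  have := L2_coef_linear l 1 (0 : L2 R d) 0.
  by rewrite scale1r addr0 mul1r => /eqP; rewrite eq_sym -subr_eq0 addrK => /eqP.
rewrite /char_sum; elim/big_rec2: _ => // i y x _ <-.
by rewrite L2_coef_linear L2_coef_torus_char.
Qed.

Lemma L2_coef_char_sum_eq i : L2_coef (k i) char_sum = c i.
Proof.
rewrite L2_coef_char_sum (bigD1 i)//= eqxx mulr1 big1 ?addr0// => j ji.
by rewrite (inj_eq k_inj) eq_sym (negPf ji) mulr0.
Qed.

(** Parseval's identity. In F F^* only the conjugate is expanded, so each term integrates to a
    multiple of a Fourier coefficient of F, which is already known. *)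
Lemma L2_norm_char_sum : L2_norm char_sum = Num.sqrt (\sum_i normc (c i) ^+ 2).
Proof.
rewrite char_sumE L2_normE; congr Num.sqrt.
set F := \sum_i c i *: torus_char_L2fun (k i).
have FE x : val F x = \sum_i c i * torus_char (k i) x.
  by rewrite /F raddf_sum/= fct_sumE; apply: eq_bigr => i _.
pose A : R := (2 * pi) `^ (- (d%:R / 2)).
have conjF x : (val F x)^* =
    \sum_i ((c i)^* * A%:C) * expi (- torus_dot (k i) x).
  rewrite FE rmorph_sum; apply: eq_bigr => i _.
  rewrite /torus_char -/A; case: (c i) => a b; apply/eqP.
  by rewrite eq_complex /expi /= cosN sinN; apply/andP; split; apply/eqP; ring.
transitivity (Re (complex_integral (fun x =>
    \sum_i ((c i)^* * A%:C) * (val F x * expi (- torus_dot (k i) x))))).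
  rewrite /complex_integral/=; apply: eq_Rintegral => x _.
  transitivity (Re (val F x *
      \sum_i ((c i)^* * A%:C) * expi (- torus_dot (k i) x))).
    by rewrite -conjF; exact: normc_sqr.
  rewrite mulr_sumr; congr Re; apply: eq_bigr => i _.
  by rewrite mulrCA.
rewrite complex_integral_sum; last first.
  by move=> i; apply: complex_integrable_fourier; exact: valP.
rewrite raddf_sum/=; apply: eq_bigr => i _.
rewrite -mulrA [A%:C * _](_ : _ = c i); last first.
  rewrite -[LHS]/(fourier_coef (k i) (val F)) -L2_coefE -char_sumE.
  exact: L2_coef_char_sum_eq.
by rewrite mulrC -normc_sqr.
Qed.

Lemma Hmix_sqnorm_char_sum s : Hmix_sqnorm s char_sum =
  (\sum_i normc (c i) ^+ 2 *
     \prod_(j < d) (1 + `|(tnth (k i) j)%:~R|) `^ (2 * s))%:E.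
Proof.
rewrite /Hmix_sqnorm (@esum_seq_support _ _ (codom k)).
- rewrite big_image -sumEFin; apply: eq_bigr => i _.
  by rewrite L2_coef_char_sum_eq.
- exact/injectiveP.
- move=> l; rewrite lee_fin mulr_ge0 ?sqr_ge0//.
  by apply: prodr_ge0 => j _; exact: powR_ge0.
- move=> l lk; rewrite L2_coef_char_sum big1.
    by rewrite Normc.normc0 expr0n mul0r.
  move=> i _.
  by case: eqP lk => [->|_ _]; rewrite ?codom_f ?mulr0.
Qed.

End span.

(** * Lower bound for approximation numbers *)

Section lower_bound.
Context {R : realType} {d : nat} (s : R).
Local Open Scope quotient_scope.

Lemma torus_char_Hmix_pred (k : d.-tuple int) :
  \pi_(L2 R d) (torus_char_L2fun k) \in Hmix_pred s.
Proof.
have : char_sum (fun _ : 'I_1 => k) (fun=> 1) =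
    \pi_(L2 R d) (torus_char_L2fun k).
  by rewrite /char_sum big_ord1 scale1r.
move=> <-; apply/asboolP; rewrite Hmix_sqnorm_char_sum ?ltry//.
by move=> i j; rewrite !ord1.
Qed.

Definition torus_char_Hmix (k : d.-tuple int) : Hmix d s :=
  Sub (\pi_(L2 R d) (torus_char_L2fun k)) (torus_char_Hmix_pred k).

(** The coordinates of the images [A (v i)] form an n by m matrix; for m < n its rows are linearly
    dependent. *)
Lemma finite_rank_kernel (X Y : lmodType R[i]) (A : {linear X -> Y}) m n
    (v : 'I_n -> X) :
  has_rank A m -> (m < n)%N ->
  exists2 c : 'I_n -> R[i], A (\sum_i c i *: v i) = 0 & exists i, c i != 0.
Proof.
move=> [e [_ _ Ae]] mn; have [M ME] := choice (fun i => Ae (v i)).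
pose B : 'M[R[i]]_(n, m) := \matrix_(i, j) M i j.
have : kermx B != 0.
  rewrite -mxrank_eq0 mxrank_ker -lt0n subn_gt0.
  exact: leq_ltn_trans (rank_leq_col B) mn.
case/rowV0Pn => c /sub_kermxP cB c0; exists (c 0).
  rewrite linear_sum.
  transitivity (\sum_i \sum_j (c 0 i * M i j) *: e j).
    apply: eq_bigr => i _; rewrite linearZ/= ME scaler_sumr.
    by apply: eq_bigr => j _; rewrite scalerA.
  rewrite exchange_big big1// => j _; rewrite -scaler_suml.
  have := congr1 (fun C : 'rV_m => C 0 j) cB; rewrite !mxE => cBj.
  rewrite (_ : \sum_i _ = 0) ?scale0r// -[RHS]cBj.
  by apply: eq_bigr => i _; rewrite mxE.
by apply/rV0Pn.
Qed.

Lemma approximation_number_ge n (k : 'I_n -> d.-tuple int) (r : R) :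
  0 < s -> 0 < r -> injective k ->
  (forall i, \prod_(j < d) (1 + `|(tnth (k i) j)%:~R|) <= r) ->
  ((r `^ (- s))%:E <= approximation_number (@Hmix_norm R d s) (@L2_norm R d)
     (Hmix_embedding d s) n)%E.
Proof.
move=> s0 r0 kI kr; apply: le_ereal_inf_tmp => _ [A [_ [m mn rk]] <-].
have [c cA [i0 ci0]] :=
  finite_rank_kernel (fun i => torus_char_Hmix (k i)) rk mn.
pose N := \sum_i normc (c i) ^+ 2.
have N0 : 0 < N.
  rewrite /N (bigD1 i0)//= ltr_wpDr//.
    by apply: sumr_ge0 => i _; exact: sqr_ge0.
  by rewrite exprn_even_gt0//=; apply: contra ci0 => /eqP /Normc.eq0_normc ->.
(* This scaling gives the test vector [x] the L_2 norm r^-s exactly; the weight bound then puts it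
   in the unit ball of [Hmix]. *)
pose t : R := r `^ (- s) / Num.sqrt N.
have t0 : 0 <= t by rewrite divr_ge0 ?powR_ge0 ?sqrtr_ge0.
have t2 : t ^+ 2 * N = (r `^ (- s)) ^+ 2.
  by rewrite /t expr_div_n sqr_sqrtr ?ltW// divfK ?gt_eqF.
pose x := t%:C *: \sum_i c i *: torus_char_Hmix (k i).
have xE : val x = char_sum k (fun i => t%:C * c i).
  rewrite -[LHS]/(Hmix_embedding d s x) /x scaler_sumr linear_sum.
  by apply: eq_bigr => i _; rewrite scalerA linearZ.
have nE i : normc (t%:C * c i) ^+ 2 = t ^+ 2 * normc (c i) ^+ 2.
  by rewrite Normc.normcM exprMn [X in X * _]normcE2/= expr0n addr0.
apply: ereal_sup_ubound; exists x.
  rewrite /= /Hmix_norm xE Hmix_sqnorm_char_sum//=.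
  rewrite -[leRHS]sqrtr1; apply: ler_wsqrtr.
  apply: le_trans (_ : \sum_i normc (t%:C * c i) ^+ 2 * r `^ (2 * s) <= _).
    apply: ler_sum => i _; rewrite ler_wpM2l ?sqr_ge0//.
    rewrite powR_prod; last by move=> j; rewrite addr_ge0.
    apply: ge0_ler_powR; rewrite ?nnegrE//.
    - by rewrite mulr_ge0// ltW.
    - by apply: prodr_ge0 => j _; rewrite addr_ge0.
    - exact: ltW.
  rewrite -mulr_suml; under eq_bigr do rewrite nE.
  rewrite -mulr_sumr -/N t2 mulr_natl mulr2n powRD ?(gt_eqF r0) ?implybT//.
  by rewrite powRN expr2 mulrACA mulVf ?mulr1// gt_eqF// powR_gt0.
(* On [x] the error of the approximation is [x] itself. *)
have -> : A x = 0 by rewrite /x linearZ/= cA scaler0.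
rewrite subr0 [Hmix_embedding _ _ _]xE L2_norm_char_sum//.
under eq_bigr do rewrite nE.
by rewrite -mulr_sumr t2 sqrtr_sqr ger0_norm ?powR_ge0.
Qed.

End lower_bound.

(** * The exponent alpha and the conclusion *)

(** The summand 1/2 keeps the argument of the logarithm above 1/2, so alpha even exceeds 1.
    Positivity allows dividing by alpha. *)
Lemma alpha_gt0 (R : realType) (n d : nat) :
  (1 < n)%N -> (0 < d)%N -> 0 < alpha n d :> R.
Proof.
move=> n1 d0; have ln2 : 0 < ln 2 :> R by rewrite ln_gt0// ltr1n.
have q0 : 0 < d%:R / log2 n%:R :> R.
  by rewrite divr_gt0 ?ltr0n// divr_gt0// ln_gt0// ltr1n.
rewrite /alpha; suff : -1 < log2 (d%:R / log2 n%:R + 2^-1 : R) by lra.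
rewrite /log2 ltr_pdivlMr// mulN1r -lnV ?posrE//.
rewrite ltr_ln ?posrE ?invr_gt0//; last first.
  by rewrite addr_gt0// invr_gt0.
by rewrite ltrDr.
Qed.

Lemma muln_alpha_le_log2 (R : realType) (n d m : nat) :
  (1 < n)%N -> (0 < d)%N ->
  (4 ^ m <= n)%N -> (2 ^ m * (m + d) ^ m <= n * m ^ m)%N ->
  m%:R * alpha n d <= log2 n%:R :> R.
Proof.
move=> n1 d0 nm4 nmd.
have ln2 : 0 < ln 2 :> R by rewrite ln_gt0// ltr1n.
have lnn : 0 < ln n%:R :> R by rewrite ln_gt0// ltr1n.
have [->|m0] := posnP m; first by rewrite mul0r divr_ge0 ?ltW.
have m0R : 0 < m%:R :> R by rewrite ltr0n.
have ln4 : ln 4 = 2 * ln 2 :> R.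
  by rewrite (_ : 4 = 2 ^+ 2 :> R) -?natrX// natrX lnXn// mulr_natl.
have Lm : 2 * m%:R <= log2 n%:R :> R.
  rewrite /log2 ler_pdivlMr// (_ : _ * ln 2 = ln (4 ^+ m)).
    by rewrite -natrX ler_ln ?posrE ?ltr0n ?expn_gt0 ?ler_nat// ltnW.
  by rewrite lnXn// ln4 -[RHS]mulr_natl mulrCA mulrA.
have q0 : 0 < d%:R / log2 n%:R :> R by rewrite divr_gt0 ?ltr0n// divr_gt0.
have qle : d%:R / log2 n%:R <= d%:R / (2 * m%:R) :> R.
  by rewrite ler_wpM2l// lef_pV2// posrE ?divr_gt0 ?mulr_gt0.
set q := d%:R / log2 n%:R in q0 qle *.
(* The summand 2 of alpha enters the logarithm as the factor 4. *)
have -> : alpha n d = ln (4 * (q + 2^-1)) / ln 2 :> R.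
  rewrite /alpha /log2 -/q lnM ?posrE ?addr_gt0 ?invr_gt0// mulrDl.
  congr (_ + _).
  by rewrite ln4 mulfK// gt_eqF.
rewrite mulrA ler_pM2r ?invr_gt0// mulr_natl.
rewrite -lnXn ?mulr_gt0 ?addr_gt0 ?invr_gt0//.
rewrite ler_ln ?posrE ?exprn_gt0 ?mulr_gt0 ?addr_gt0 ?invr_gt0 ?ltr0n//;
  last first.
  exact: ltnW.
(* By q <= d / (2m), the base 4q + 2 is at most 2 (m + d) / m. *)
apply: le_trans (_ : (2 * (m + d)%:R / m%:R) ^+ m <= _).
  apply: lerXn2r; rewrite ?nnegrE.
  - by rewrite mulr_ge0// addr_ge0 ?invr_ge0// ltW.
  - by rewrite divr_ge0 ?mulr_ge0.
  rewrite ler_pdivlMr// natrD.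
  have : q * (2 * m%:R) <= d%:R by rewrite -ler_pdivlMr ?mulr_gt0.
  lra.
by rewrite expr_div_n ler_pdivrMr ?exprn_gt0// exprMn -!natrX -!natrM ler_nat.
Qed.

Theorem theorem4p10 (R : realType) (d : nat) (s : R) (n : nat)
    (hd : (2 <= d)%N) (hs : 0 < s) (hn : (2 <= n)%N)
    (hnd : n%:R <= d%:R / 2 * 4 ^+ d :> R) :
  ((2 `^ (- s) * n%:R `^ (- (s / alpha n d)))%:E <=
   approximation_number (@Hmix_norm R d s) (@L2_norm R d)
     (Hmix_embedding d s) n)%E.
Proof.
have nd : (2 * n <= d * 4 ^ d)%N.
  rewrite -(ler_nat R) !natrM natrX; move: hnd; lra.
have [m [nm nm4 nmd]] := exists_dyadic_level hd hn nd.
(* The default of [nth] is never reached, since level m + 1 has at least n points. *)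
pose k (i : 'I_n) : d.-tuple int :=
  nth [tuple of nseq d 0] (dyadic_points d m.+1) i.
have ki (i : 'I_n) : (i < size (dyadic_points d m.+1))%N.
  exact: leq_trans (ltn_ord i) nm.
have kI : injective k.
  move=> i j /eqP; rewrite /k nth_uniq ?dyadic_points_uniq ?ki// => /eqP.
  exact: val_inj.
have kr i : \prod_(j < d) (1 + `|(tnth (k i) j)%:~R|) <= 2 ^+ m.+1 :> R.
  have := dyadic_points_weight (mem_nth [tuple of nseq d 0] (ki i)).
  rewrite -(ler_nat R) natrX natr_prod; apply: le_trans.
  rewrite le_eqVlt; apply/orP; left; apply/eqP.
  by apply: eq_bigr => j _; rewrite natrD natr_absz intr_norm.
apply: le_trans (approximation_number_ge hs _ kI kr); last exact: exprn_gt0.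
(* One factor 2 of the radius 2^(m+1) accounts for 2^-s. What remains, n^(-s/alpha) <= (2^m)^-s,
   becomes m alpha <= log2 n after taking logarithms. *)
rewrite lee_fin exprS powRM ?exprn_ge0// ler_wpM2l ?powR_ge0//.
have a0 := @alpha_gt0 R n d hn (ltnW hd).
have := @muln_alpha_le_log2 R n d m hn (ltnW hd) nm4 nmd.
have ln2 : 0 < ln 2 :> R by rewrite ln_gt0// ltr1n.
rewrite -ler_pdivlMr// /log2 => mle.
rewrite /powR !gt_eqF ?exprn_gt0 ?ltr0n ?(ltnW hn)//.
rewrite ler_expR lnXn// !mulNr lerN2.
rewrite -mulrA ler_pM2l// -[_ *+ m]mulr_natl.
by move: mle; rewrite mulrAC ler_pdivlMr// [_^-1 * _]mulrC.
Qed.
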